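(* Suppose $(t^*,x^*,w^* )$ is an optimizer of the linear conic problem (P) and $(\gamma_0^*,\gamma^*,y_1^*,\ldots,y_m^* )$ is an optimizer of its dual problem (D). Assume that $S$ is compact, that $K=\overline{K}$, and that strong duality holds between (P) and (D) (their optimal values are equal). Then the problem (D) is equivalent to the problem (DRO) in the sense that they share the same optimal value and that $y^*=y_1^*+\cdots+y_m^*$ admits a nonzero multiple of a worst-case measure $\mu^*\in\mathcal{M}$ (that is, there are a scalar $c\neq0$ and $\mu^*\in\mathcal M$ such that $y^*_\alpha=c\int_S\xi^\alpha\,d\mu^*$ for all $\alpha\in\mathbb{N}_d^p$) that satisfies $$\mathbb{E}_{\mu^*}\Big[\inf_{j\in[m]}f_j(t^*,x^*,\lambda,\xi)\Big]=\inf_{\mu\in\mathcal{M}}\mathbb{E}_\mu\Big[\inf_{j\in[m]}f_j(t^*,x^*,\lambda,\xi)\Big]=0.$$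
   Context: Notation. $[m]=\{1,\ldots,m\}$; $\mathbb{N}_d^p=\{\alpha\in\mathbb{N}^p:|\alpha|\le d\}$; $[\xi]_d$ is the vector of all monomials $\xi^\alpha$, $\alpha\in\mathbb{N}_d^p$, in $\xi=(\xi_1,\ldots,\xi_p)$; $e=(1,\ldots,1)^\top\in\mathbb{R}^n$; $e_1=(1,0,\ldots,0)^\top\in\mathbb{R}^{\mathbb{N}_d^p}$ (the entry $1$ is at $\alpha=0$). $\mathrm{cone}(\cdot)$ denotes the conic hull (all finite nonnegative combinations), and an overline denotes closure. $S\subseteq\mathbb{R}^p$ is a given set, $\mathcal{P}(S)$ the set of probability measures supported on $S$. Vectors $y=(y_\alpha)\in\mathbb{R}^{\mathbb{N}_d^p}$ are called truncated multi-sequences (tms); $y$ admits a measure $\mu$ on $S$ if $y_\alpha=\int_S\xi^\alpha d\mu$ for all $\alpha\in\mathbb{N}_d^p$. Polynomials $q=\sum q_\alpha\xi^\alpha$ of degree at most $d$ and tms are paired by $\langle q,y\rangle=\sum_\alpha q_\alpha y_\alpha$, and dual cones are taken with respect to this pairing: for a set $C$ of tms, $C^*=\{q\in\mathbb{R}[\xi]_d:\langle q,y\rangle\ge0\ \forall y\in C\}$. The DRO problem. $r=(r_1,\ldots,r_n)^\top$ is a vector of polynomials in $\xi$ with $\deg(r)=d$ (maximum degree of the $r_i$); $\lambda>0$; $l(Z)=\max_{1\le j\le m}\{a_jZ+b_j\}$ with real $a_j,b_j$ is an increasing, non-constant loss function; $X=\{x\in\mathbb{R}^n:x\ge0,\ e^\top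 x=1\}$. $\mathcal{B}\subseteq\mathbb{R}^{\mathbb{N}_d^p}$ is a (convex) set given by linear, second-order or semidefinite constraints, and $\mathcal{M}=\{\mu\in\mathcal{P}(S):\mathbb{E}_\mu([\xi]_d)\in\mathcal{B}\}$. The problem is $$\text{(DRO)}\quad\min_{(t,x)}\ t\quad\text{s.t. }\ \sup_{\mu\in\mathcal{M}}\mathbb{E}_\mu[l(-x^\top r(\xi)-t)]\le\lambda,\ \ x\in X,\ t\in\mathbb{R}.$$ Let $f_j(t,x,\lambda,\xi)=\lambda-(a_j(-x^\top r(\xi)-t)+b_j)$, and let $A_j$ (matrix with $\binom{p+d}{d}$ rows and $n$ columns) and $c_j\in\mathbb{R}^{\binom{p+d}{d}}$ be the unique ones such that $f_j(t,x,\lambda,\xi)=(a_je_1t+A_jx+c_j)^\top[\xi]_d$. Cones. $\mathscr{P}_d(S)$ is the cone of real polynomials in $\xi$ of degree at most $d$ that are nonnegative on $S$; $\mathscr{R}_d(S)=\mathrm{cone}(\{[\xi]_d:\xi\in S\})$ is the cone of tms of degree $d$ admitting a nonnegative measure on $S$; and $$K=\mathrm{cone}(\{\mathbb{E}_\mu[[\xi]_d]:\mu\in\mathcal{M}\})=\mathscr{R}_d(S)\cap\mathrm{cone}(\mathcal{B})$$ (the set $\mathcal B$ is understood to be such that these two descriptions agree). The conic problems are $$\text{(P)}\quad\min_{(t,x,w)}\ t\quad\text{s.t. }\ t\in\mathbb{R},\ w^\top[\xi]_d\in K^*,\ x\in X,\ (a_je_1t+A_jx+c_j-w)^\top[\xi]_d\in\mathscr{P}_d(S)\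 \ \forall j\in[m],$$ $$\text{(D)}\quad\max_{(\gamma_0,\gamma,y_1,\ldots,y_m)}\ \gamma_0-\sum_{j=1}^mc_j^\top y_j\quad\text{s.t. }\begin{cases}\gamma_0\in\mathbb{R},\ \gamma\in\mathbb{R}^n,\ \gamma\ge0,\ y_j\in\overline{\mathscr{R}_d(S)}\ (j\in[m]),\\ \sum_{j=1}^ma_j(e_1^\top y_j)=1,\ \ \gamma_0e+\gamma+\sum_{j=1}^mA_j^\top y_j=0,\\ y_1+\cdots+y_m\in\overline{K}.\end{cases}$$ *)

(* Defs.v *)
From HB Require Import structures.
From mathcomp Require Import all_boot all_order all_algebra.
From mathcomp Require Import all_classical all_reals all_analysis.
(* The notations of multinomials clash with those of MathComp-Analysis. *)
From mathcomp Require Import -(notations) mpoly.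

Set Implicit Arguments.
Unset Strict Implicit.
Unset Printing Implicit Defensive.

Import Order.TTheory GRing.Theory Num.Theory.
Import numFieldNormedType.Exports.

Local Open Scope classical_set_scope.
Local Open Scope ring_scope.

(** * Truncated multi-sequences and cones *)

(* N_d^p: the multi-indices alpha in N^p with |alpha| < d.+1. *)
Definition expo (p d : nat) : finType := bmultinom p d.+1.

(* R^(N_d^p), as column vectors whose row k is the entry at the multi-index
   [enum_val k]. It also serves as R[xi]_d: a vector q stands for the
   polynomial q^T [xi]_d. *)
Notation tms R p d := 'cV[R]_#|expo p d|.

Section Tms.
Variables (R : realType) (p d : nat).

Definition monomial (alpha : expo p d) (xi : 'rV[R]_p) : R :=
  \prod_(i < p) xi ord0 i ^+ (bmnm alpha) i.

(* [xi]_d *)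
Definition monvec (xi : 'rV[R]_p) : tms R p d :=
  \col_k monomial (enum_val k) xi.

(* e_1, with its entry 1 at alpha = 0 *)
Definition e1 : tms R p d := \col_k (bmnm (enum_val k) == mnm0)%:R.

Definition pairing (q y : tms R p d) : R := \sum_k q k ord0 * y k ord0.

Definition dual_cone (C : set (tms R p d)) : set (tms R p d) :=
  [set q | forall y, C y -> 0 <= pairing q y].

(* Since s may be 0, the conic hull always contains 0. *)
Definition conic_hull (C : set (tms R p d)) : set (tms R p d) :=
  [set y | exists (s : nat) (u : 'I_s -> R) (v : 'I_s -> tms R p d),
     [/\ forall i, 0 <= u i, forall i, C (v i) & y = \sum_i u i *: v i]].

(* script-P_d(S) *)
Definition nonneg_polys (S : set 'rV[R]_p) : set (tms R p d) :=
  [set q | forall xi, S xi -> 0 <= pairing q (monvec xi)].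

(* script-R_d(S) *)
Definition moment_cone (S : set 'rV[R]_p) : set (tms R p d) :=
  conic_hull (monvec @` S).

End Tms.

Arguments monvec {R p} d xi.
Arguments e1 {R p d}.
Arguments moment_cone {R p} d S.

(** * Sets given by linear, second-order and semidefinite constraints *)

Definition norm2 (R : realType) (k : nat) (v : 'cV[R]_k) : R :=
  Num.sqrt (\sum_i v i ord0 ^+ 2).

Definition psd (R : realType) (k : nat) (Q : 'M[R]_k) : Prop :=
  Q^T = Q /\ forall v : 'cV[R]_k, 0 <= (v^T *m Q *m v) ord0 ord0.

(* [Lmi F0 F] is the constraint that F0 + sum_i y_i F_i be symmetric and positive
   semidefinite; for non-symmetric data this adds linear equations in y. *)
Inductive conic_constraint (R : realType) (N : nat) : Type :=
| LinEq of 'cV[R]_N & R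
| LinGe of 'cV[R]_N & R
| Soc (k : nat) of 'M[R]_(k, N) & 'cV[R]_k & 'cV[R]_N & R
| Lmi (k : nat) of 'M[R]_k & ('I_N -> 'M[R]_k).

Definition satisfies (R : realType) (N : nat) (y : 'cV[R]_N)
    (cc : conic_constraint R N) : Prop :=
  let aff q h := (q^T *m y) ord0 ord0 + h in
  match cc with
  | LinEq q h => aff q h = 0
  | LinGe q h => 0 <= aff q h
  | Soc k G g q h => norm2 (G *m y + g) <= aff q h
  | Lmi k F0 F => psd (F0 + \sum_i y i ord0 *: F i)
  end.

Definition conic_representable (R : realType) (N : nat) (B : set 'cV[R]_N) :
    Prop :=
  exists (s : nat) (cc : 'I_s -> conic_constraint R N),
    B = [set y | forall i, satisfies y (cc i)].

(** * Measures and moments *)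

(* R^p with its Borel sigma-algebra *)
Definition borelRn (R : realType) (p : nat) :=
  g_sigma_algebraType (@open 'rV[R]_p).

Section Measures.
Variables (R : realType) (p d : nat).

(* P(S); for closed S, this says that the support of mu lies in S. *)
Definition prob_on (S : set 'rV[R]_p) :
    set (probability (borelRn R p) R) :=
  [set mu | mu.-negligible (~` S : set (borelRn R p))].

(* Equality in \bar R forces the moments of order at most d to be finite. *)
Definition admits (S : set 'rV[R]_p)
    (mu : {measure set (borelRn R p) -> \bar R}) (y : tms R p d) : Prop :=
  forall k, (y k ord0)%:E =
    (\int[mu]_(xi in (S : set (borelRn R p)))
       (monomial (enum_val k) (xi : 'rV[R]_p))%:E)%E.

(* script-M. For mu in P(S), the tms admitting mu is E_mu([xi]_d). *)
Definition ambiguity (S : set 'rV[R]_p) (B : set (tms R p d)) :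
    set (probability (borelRn R p) R) :=
  [set mu | prob_on S mu /\ exists2 y, B y & admits S mu y].

(* K *)
Definition ambiguity_cone (S : set 'rV[R]_p) (B : set (tms R p d)) :
    set (tms R p d) :=
  conic_hull [set y | exists2 mu, ambiguity S B mu & admits S mu y].

End Measures.

(** * The three optimization problems *)

Definition simplex (R : realType) (n : nat) : set 'cV[R]_n :=
  [set x | (forall i, 0 <= x i ord0) /\ \sum_i x i ord0 = 1].

Arguments simplex {R n}.

Section Loss.
Variables (R : realType) (p n m : nat).
Variables (r : 'I_n -> mpoly p R) (a b : 'I_m.+1 -> R).

(* The default value of the iterated maximum is one of its terms, so that this
   is the maximum over j; likewise for the minimum below. *)
Definition loss (z : R) : R :=
  \big[Num.max/a ord0 * z + b ord0]_j (a j * z + b j).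

(* x^T r(xi) *)
Definition portfolio (x : 'cV[R]_n) (xi : 'rV[R]_p) : R :=
  \sum_i x i ord0 * meval (fun k => xi ord0 k) (r i).

(* f_j(t, x, lambda, xi) *)
Definition fpiece (j : 'I_m.+1) (t : R) (x : 'cV[R]_n) (lambda : R)
    (xi : 'rV[R]_p) : R :=
  lambda - (a j * (- portfolio x xi - t) + b j).

Definition fmin (t : R) (x : 'cV[R]_n) (lambda : R) (xi : 'rV[R]_p) : R :=
  \big[Num.min/fpiece ord0 t x lambda xi]_j fpiece j t x lambda xi.

Definition dro_feasible (M : set (probability (borelRn R p) R)) (lambda : R)
    (t : R) (x : 'cV[R]_n) : Prop :=
  (ereal_sup [set 'E_mu[fun xi => loss (- portfolio x xi - t)] | mu in M]
     <= lambda%:E)%E /\ simplex x.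

Definition dro_value (M : set (probability (borelRn R p) R)) (lambda : R) :
    \bar R :=
  ereal_inf [set t%:E | t in [set t | exists x, dro_feasible M lambda t x]].

End Loss.

Section ConicProblems.
Variables (R : realType) (p d n m : nat).
Variables (S : set 'rV[R]_p) (K : set (tms R p d)) (a : 'I_m -> R).
Variables (A : 'I_m -> 'M[R]_(#|expo p d|, n)) (c : 'I_m -> tms R p d).

(* a_j e_1 t + A_j x + c_j *)
Definition fcoef (j : 'I_m) (t : R) (x : 'cV[R]_n) : tms R p d :=
  (a j * t) *: e1 + A j *m x + c j.

Definition P_feasible (t : R) (x : 'cV[R]_n) (w : tms R p d) : Prop :=
  [/\ dual_cone K w, simplex x &
      forall j, nonneg_polys S (fcoef j t x - w)].

Definition P_optimizer (t : R) (x : 'cV[R]_n) (w : tms R p d) : Prop :=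
  P_feasible t x w /\ forall t' x' w', P_feasible t' x' w' -> t <= t'.

Definition P_value : \bar R :=
  ereal_inf [set t%:E | t in [set t | exists x w, P_feasible t x w]].

Definition D_objective (g0 : R) (y : 'I_m -> tms R p d) : R :=
  g0 - \sum_j pairing (c j) (y j).

Definition D_feasible (g0 : R) (g : 'cV[R]_n) (y : 'I_m -> tms R p d) : Prop :=
  [/\ forall i, 0 <= g i ord0,
      forall j, closure (moment_cone d S) (y j),
      \sum_j a j * pairing e1 (y j) = 1,
      g0 *: const_mx 1 + g + \sum_j (A j)^T *m y j = 0 &
      closure K (\sum_j y j)].

Definition D_optimizer (g0 : R) (g : 'cV[R]_n) (y : 'I_m -> tms R p d) : Prop :=
  D_feasible g0 g y /\ forall g0' g' y',
    D_feasible g0' g' y' -> D_objective g0' y' <= D_objective g0 y.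

Definition D_value : \bar R :=
  ereal_sup [set v%:E | v in
    [set v | exists g0 g y, D_feasible g0 g y /\ v = D_objective g0 y]].

End ConicProblems.

(* Main.v *)
Require Import Defs.
From HB Require Import structures.
From mathcomp Require Import all_boot all_order all_algebra.
From mathcomp Require Import all_classical all_reals all_analysis.
From mathcomp Require Import -(notations) mpoly.
From mathcomp Require Import measurable_realfun ring.

Import Order.TTheory GRing.Theory Num.Theory.
Import numFieldNormedType.Exports.

Local Open Scope classical_set_scope.
Local Open Scope ring_scope.

Set Implicit Arguments.
Unset Strict Implicit.
Unset Printing Implicit Defensive.

(** Write v = gamma_0 - sum_j <c_j, y_j> for the dual value at the optimizer.
    Everything follows from two weak-duality inequalities and the closedness of
    the moment cone.

    A point (t, x, w) feasible for (P) has w^T[xi]_d <= f_j(t, x, lambda, xi) on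
    S for every j. Integrating against a measure of M, whose moments lie in K,
    on which w is nonnegative, gives E_mu[min_j f_j] >= 0
    ([P_feasible_expectation]). Since min_j f_j = lambda - l(-x^T r - t)
    ([fmin_loss]), this is the constraint of (DRO) ([expectation_loss_le]).

    In the other direction, a dual feasible point produces one measure that
    bounds t from below for every (t, x) feasible for (DRO)
    ([dual_feasible_measure]). As S is compact and the constant polynomial 1 is
    positive on it, the moment cone is closed ([moment_cone_closed]); hence each
    y_j is the moment vector of finitely many weighted atoms in S
    ([moment_cone_atoms]). The union of all these atoms has moments
    y_1 + ... + y_m in K. Its total mass k is positive since
    sum_j a_j <e_1, y_j> = 1, and normalizing it gives a measure mu in M,
    because the moments of mu are a convex combination of points of B
    ([ambiguity_cone_normalize]). At an atom coming from y_j, bound min_i f_i by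
    f_j: the linear constraints of (D) then turn the sum of the f_j into
    k E_mu[min_j f_j(t, x)] <= t - v ([sum_fcoef]).

    If (t, x) is feasible for (DRO), the left side is nonnegative, so v <= t.
    The optimizer (t_P, x_P) of (P) is feasible for (DRO) and satisfies t_P = v
    by strong duality, so both problems have the value v; moreover
    0 <= E_mu[min_j f_j(t_P, x_P)] <= (t_P - v) / k = 0, so mu is a worst-case
    measure. *)

(** * The pairing of polynomials and moment sequences *)

Lemma pairingE (R : realType) (p d : nat) (q y : tms R p d) :
  pairing q y = (q^T *m y) ord0 ord0.
Proof. by rewrite mxE; apply: eq_bigr => i _; rewrite mxE. Qed.

Lemma pairingDl (R : realType) (p d : nat) (q1 q2 y : tms R p d) :
  pairing (q1 + q2) y = pairing q1 y + pairing q2 y.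
Proof. by rewrite -big_split; apply: eq_bigr => k _; rewrite mxE mulrDl. Qed.

Lemma pairingZl (R : realType) (p d : nat) (u : R) (q y : tms R p d) :
  pairing (u *: q) y = u * pairing q y.
Proof. by rewrite mulr_sumr; apply: eq_bigr => k _; rewrite mxE mulrA. Qed.

Lemma pairing_sumr (R : realType) (p d : nat) (q : tms R p d) (I : finType)
    (P : pred I) (u : I -> R) (v : I -> tms R p d) :
  pairing q (\sum_(i | P i) u i *: v i) = \sum_(i | P i) u i * pairing q (v i).
Proof.
rewrite pairingE mulmx_sumr summxE; apply: eq_bigr => i _.
by rewrite -scalemxAr mxE pairingE.
Qed.

(** The polynomial encoded by e_1 is the constant 1, so that pairing with [e1]
    reads off the total mass of a measure. *)
Lemma pairing_e1_monvec (R : realType) (p d : nat) (xi : 'rV[R]_p) :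
  pairing e1 (monvec d xi) = 1.
Proof.
have m0 : (mdeg (@mnm0 p) < d.+1)%N by rewrite mdeg0.
pose k0 : 'I_#|expo p d| := enum_rank (BMultinom m0).
rewrite /pairing (bigD1 k0)//= big1 ?addr0; last first.
  move=> k kk0; rewrite mxE; case: eqP => [k_0|]; last by rewrite mul0r.
  case/negP: kk0; apply/eqP/enum_val_inj; rewrite enum_rankK.
  exact/val_inj.
rewrite !mxE enum_rankK eqxx mul1r /monomial big1// => i _.
by rewrite mnm0E expr0.
Qed.

(** * Continuity of the monomial map *)

Lemma continuous_entry (T : topologicalType) (m n : nat) i j :
  continuous (fun M : 'M[T]_(m, n) => M i j).
Proof.
move=> M U MU; exists (fun i' j' => [set x | i' = i -> j' = j -> U x]).
  move=> i' j'; have [->|ni] := eqVneq i' i; last first.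
    by apply: nearW => x ii; rewrite ii eqxx in ni.
  have [->|nj] := eqVneq j' j; last first.
    by apply: nearW => x _ jj; rewrite jj eqxx in nj.
  by apply: filterS MU => x Ux _ _.
by move=> M' /(_ i j); apply.
Qed.

Lemma continuous_mx (T U : topologicalType) (m n : nat)
    (f : U -> 'M[T]_(m, n)) :
  (forall i j, continuous (fun x => f x i j)) -> continuous f.
Proof.
move=> cf x A [P xP PA]; have : \forall y \near x, forall i j, P i j (f y i j).
  by apply: filter_forall => i; apply: filter_forall => j; exact/cf/xP.
by apply: filterS => y Py; exact: PA.
Qed.

Lemma pairing_continuous (R : realType) (p d : nat) (q : tms R p d) :
  continuous (pairing q).
Proof.
apply: continuous_big => [z|i _ y]; first exact: add_continuous.
by apply: continuousM; [exact: cst_continuous | exact: coord_continuous].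
Qed.

Lemma monomial_continuous (R : realType) (p d : nat) (alpha : expo p d) :
  continuous (@monomial R p d alpha).
Proof.
apply: continuous_big => [z|i _ x].
  by apply: continuousM; [exact: cvg_fst|exact: cvg_snd].
by apply: (@continuous_comp _ _ _ (fun x : 'rV[R]_p => x ord0 i)
  (fun x : R => x ^+ bmnm alpha i));
  [exact: coord_continuous|exact: exprn_continuous].
Qed.

Lemma monvec_continuous (R : realType) (p d : nat) :
  continuous (@monvec R p d).
Proof.
apply: continuous_mx => k j; rewrite (_ : (fun _ => _) = monomial (enum_val k)).
  exact: monomial_continuous.
by apply/funext => x; rewrite mxE.
Qed.

Lemma pairing_monvec_continuous (R : realType) (p d : nat) (q : tms R p d) :
  continuous (fun xi => pairing q (monvec d xi)).
Proof.
by move=> x; apply: (@continuous_comp _ _ _ (monvec d) (pairing q));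
  [exact: monvec_continuous|exact: pairing_continuous].
Qed.

(** * Conic hulls of compact sets *)

(** The pivot of the simplex method: moving along a linear relation until the
    first coefficient reaches 0 removes one vector. *)
Lemma conic_relation_drop (R : realType) (N s : nat)
    (v : 'I_s.+1 -> 'cV[R]_N) (u c : 'I_s.+1 -> R) :
  (forall i, 0 <= u i) -> \sum_i c i *: v i = 0 -> (exists i, 0 < c i) ->
  exists (k : 'I_s.+1) (u' : 'I_s -> R), (forall i, 0 <= u' i) /\
    \sum_i u i *: v i = \sum_i u' i *: v (lift k i).
Proof.
move=> u0 cv [i0 ci0].
case: (@Order.TotalTheory.arg_minP _ _ _ i0 (fun i => 0 < c i)
  (fun i => u i / c i) ci0) => k ck kmin.
exists k, (fun i => u (lift k i) - u k / c k * c (lift k i)); split.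
  move=> i; rewrite subr_ge0; have [ci|ci] := ltP 0 (c (lift k i)).
    by rewrite -ler_pdivlMr// kmin.
  by apply: le_trans (u0 _); rewrite mulr_ge0_le0// divr_ge0// ltW.
have -> : \sum_i u i *: v i = \sum_i (u i - u k / c k * c i) *: v i.
  under [RHS]eq_bigr do rewrite scalerBl -scalerA.
  by rewrite sumrB -scaler_sumr cv scaler0 subr0.
by rewrite (bigD1_ord k)//= divfK ?gt_eqF// subrr scale0r add0r.
Qed.

(** Fixing the number of terms turns the conic hull into the image of a product
    set under one continuous map. *)
Definition conic_comb (R : realType) (N : nat) (V : set 'cV[R]_N) (s : nat) :
    set 'cV[R]_N :=
  [set y | exists (u : 'I_s -> R) (v : 'I_s -> 'cV[R]_N),
     [/\ forall i, 0 <= u i, forall i, V (v i) & y = \sum_i u i *: v i]].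

(** More than N vectors of an N-dimensional space are linearly dependent. *)
Lemma conic_comb_pred (R : realType) (N : nat) (V : set 'cV[R]_N) (s : nat) :
  (N <= s)%N -> conic_comb V s.+1 `<=` conic_comb V s.
Proof.
move=> Ns _ [u [v [u0 Vv ->]]].
suff [c cv cpos] : exists2 c : 'I_s.+1 -> R,
    \sum_i c i *: v i = 0 & exists i, 0 < c i.
  have [k [u' [u'0 ->]]] := conic_relation_drop u0 cv cpos.
  by exists u', (v \o lift k); split => // i; exact: Vv.
pose A : 'M[R]_(s.+1, N) := \matrix_(i, j) v i j ord0.
have : kermx A != 0.
  rewrite kermx_eq0 /row_free; apply/negP => /eqP rA.
  by have := rank_leq_col A; rewrite rA leqNgt ltnS Ns.
case/rowV0Pn => w /sub_kermxP wA w0.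
have wv : \sum_i w ord0 i *: v i = 0.
  apply/colP => j; move/rowP/(_ j): wA; rewrite summxE !mxE => wAj.
  rewrite -[RHS]wAj.
  by apply: eq_bigr => i _; rewrite !mxE.
have [i wi] : exists i, w ord0 i != 0 by exact/rV0Pn.
have [wi0|wi0] := ltP 0 (w ord0 i); first by exists (w ord0) => //; exists i.
(* When all that is known is a negative entry, the opposite relation serves. *)
exists (fun i => - w ord0 i); last first.
  by exists i; rewrite oppr_gt0 lt_neqAle wi wi0.
by under eq_bigr do rewrite scaleNr; rewrite sumrN wv oppr0.
Qed.

Lemma conic_comb_succ (R : realType) (N : nat) (V : set 'cV[R]_N) (s : nat) :
  V !=set0 -> conic_comb V s `<=` conic_comb V s.+1.
Proof.
move=> [v0 Vv0] _ [u [v [u0 Vv ->]]].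
(* The added vector is any element of V, with coefficient 0. *)
exists (fun i => oapp u 0 (unlift ord0 i)),
  (fun i => oapp v v0 (unlift ord0 i)).
split=> [i|i|]; [by case: unlift => /= | by case: unlift => /= | ].
rewrite big_ord_recl unlift_none/= scale0r add0r.
by apply: eq_bigr => i _; rewrite liftK.
Qed.

Lemma caratheodory (R : realType) (N : nat) (V : set 'cV[R]_N) (s : nat) :
  V !=set0 -> conic_comb V s `<=` conic_comb V N.
Proof.
move=> V0; have [sN|/ltnW Ns] := leqP s N.
  have up k : conic_comb V s `<=` conic_comb V (k + s).
    elim: k => [|k IH] y; first by rewrite add0n.
    by move=> /IH; exact: conic_comb_succ.
  by have := up (N - s)%N; rewrite subnK.
have down k : conic_comb V (k + N) `<=` conic_comb V N.
  elim: k => [|k IH] y; first by rewrite add0n.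
  by move=> /conic_comb_pred yV; apply/IH/yV/leq_addl.
by have := down (s - N)%N; rewrite subnK.
Qed.

Lemma conic_hullE (R : realType) (p d : nat) (V : set (tms R p d)) :
  V !=set0 -> conic_hull V = conic_comb V #|expo p d|.
Proof.
move=> V0; apply/seteqP; split=> y; last by exists #|expo p d|.
by move=> [s]; exact: caratheodory.
Qed.

(** The functional q bounds the coefficients of all combinations near a given
    point, so that the closure only sees the image of a compact set. Compactness
    of V is not enough: a disc whose boundary contains the origin spans an open
    half-plane together with the origin. *)
Lemma conic_hull_closed (R : realType) (p d : nat) (V : set (tms R p d))
    (q : tms R p d) :
  compact V -> (forall v, V v -> pairing q v = 1) ->
  closed (conic_hull V).
Proof.
move=> cV qV; have [->|V0] := eqVneq V set0.
  have -> : conic_hull set0 = [set (0 : tms R p d)].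
    apply/seteqP; split=> [y [[|s] [u [v [_ Vv ->]]]]|y ->].
    - by rewrite big_ord0.
    - by case: (Vv ord0).
    - by exists 0%N, (fun=> 0), (fun=> 0); split=> [i|[]|]//; rewrite big_ord0.
  exact: (compact_closed (@norm_hausdorff _ _) (@compact_set1 _ _)).
have {}V0 : V !=set0 by exact/set0P.
have cell := @pairing_continuous _ _ _ q.
rewrite conic_hullE// => y yV.
pose N := #|expo p d|.
(* N terms suffice by Caratheodory; near y the functional q is at most its value
   at y plus 1, and so is every coefficient. *)
pose F (z : 'rV[R]_N * 'rV[tms R p d]_N) := \sum_i z.1 ord0 i *: z.2 ord0 i.
pose C1 := [set u : 'rV[R]_N |
  forall i, `[0, pairing q y + 1]%classic (u ord0 i)].
pose C2 := [set w : 'rV[tms R p d]_N | forall i, V (w ord0 i)].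
have cF : continuous F.
  apply: continuous_big => [x|i _ z]; first exact: add_continuous.
  apply: (continuousZ (s := fun z : 'rV[R]_N * 'rV[tms R p d]_N => z.1 ord0 i)
    (f := fun z : 'rV[R]_N * 'rV[tms R p d]_N => z.2 ord0 i)).
    by apply: (@continuous_comp _ _ _ fst (fun u : 'rV[R]_N => u ord0 i));
      [exact: cvg_fst|exact: continuous_entry].
  by apply: (@continuous_comp _ _ _ snd
    (fun w : 'rV[tms R p d]_N => w ord0 i));
    [exact: cvg_snd|exact: continuous_entry].
have cC : compact (C1 `*` C2).
  apply: compact_setX.
    apply: (@rV_compact R N (fun=> `[0, pairing q y + 1]%classic)) => i.
    exact: segment_compact.
  exact: (@rV_compact (tms R p d) N (fun=> V)).
have cFC : closed (F @` (C1 `*` C2)).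
  apply: compact_closed; first exact: norm_hausdorff.
  apply: continuous_compact => //; exact: continuous_subspaceT.
suff [[u w] [/= Cu Cw] <-] : (F @` (C1 `*` C2)) y.
  exists (u ord0), (w ord0); split => // i.
  by have := Cu i; rewrite /= in_itv/= => /andP[].
apply: cFC => U Uy.
have : nbhs y (pairing q @^-1` [set x | x < pairing q y + 1]).
  by apply: (cell y); apply: lt_nbhsl; rewrite ltrDl.
move/(filterI Uy)/yV => [w [[u [v [u0 Vv wE]]] [Uw lw]]].
exists w; split => //; exists (\row_i u i, \row_i v i); last first.
  by rewrite wE /F; apply: eq_bigr => i _; rewrite !mxE.
split=> i; rewrite mxE//= in_itv/= u0/=.
apply: le_trans (ltW lw); rewrite wE pairing_sumr (bigD1 i)//= qV// mulr1 lerDl.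
by rewrite sumr_ge0// => j _; rewrite qV// mulr1.
Qed.

Lemma moment_cone_closed (R : realType) (p d : nat) (S : set 'rV[R]_p) :
  compact S -> closed (moment_cone d S).
Proof.
move=> cS; apply: (conic_hull_closed (q := e1)); last first.
  by move=> _ [xi _ <-]; exact: pairing_e1_monvec.
apply: continuous_compact => //.
exact/continuous_subspaceT/monvec_continuous.
Qed.

(** The label of an atom remembers the sequence that it comes from; one index
    type for all atoms lets them be merged into a single measure. *)
Lemma moment_cone_atoms (R : realType) (p d : nat) (S : set 'rV[R]_p)
    (J : finType) (y : J -> tms R p d) : (forall j, moment_cone d S (y j)) ->
  exists (I : finType) (u : I -> R) (xi : I -> 'rV[R]_p) (lab : I -> J),
    [/\ forall i, 0 <= u i, forall i, S (xi i) &
        forall j, y j = \sum_(i | lab i == j) u i *: monvec d (xi i)].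
Proof.
move=> Sy.
have {}Sy j : exists w : {s & ('I_s -> R) * ('I_s -> 'rV[R]_p)}%type,
    [/\ forall i, 0 <= (tagged w).1 i, forall i, S ((tagged w).2 i) &
        y j = \sum_i (tagged w).1 i *: monvec d ((tagged w).2 i)].
  have [s [u [v [u0 Sv ->]]]] := Sy j.
  have /choice[xi xiv] : forall i, exists xi, S xi /\ monvec d xi = v i.
    by move=> i; have [xi] := Sv i; exists xi.
  exists (existT _ s (u, xi)); split=> //= [i|]; first by case: (xiv i).
  by apply: eq_bigr => i _; case: (xiv i) => _ ->.
have [w wP] := choice Sy.
exists {j : J & 'I_(tag (w j))},
  (fun i => (tagged (w (tag i))).1 (tagged i)),
  (fun i => (tagged (w (tag i))).2 (tagged i)), (fun i => tag i).
split=> [i|i|j]; [by case: (wP (tag i)) | by case: (wP (tag i)) |].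
case: (wP j) => _ _ ->.
under [RHS]eq_bigl do rewrite -[_ == _]andbT.
by rewrite -(sig_big_dep (fun i => i == j) (fun i _ => true)
  (fun i k => (tagged (w i)).1 k *: monvec d ((tagged (w i)).2 k)))
  big_pred1_eq.
Qed.

(** * Integration over compactly supported measures *)

Lemma open_borelRn (R : realType) (p : nat) (A : set 'rV[R]_p) :
  open A -> measurable (A : set (borelRn R p)).
Proof. exact: sub_sigma_algebra. Qed.

Lemma closed_borelRn (R : realType) (p : nat) (A : set 'rV[R]_p) :
  closed A -> measurable (A : set (borelRn R p)).
Proof.
move=> /closed_openC/open_borelRn/measurableC; rewrite setCK; exact.
Qed.

Lemma continuous_borelRn (R : realType) (p : nat) (f : 'rV[R]_p -> R)
    (D : set (borelRn R p)) :
  continuous f -> measurable D -> measurable_fun D (f : borelRn R p -> R).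
Proof.
move=> /continuousP cf mD; apply: measurable_funS (@subsetT _ _) _ => //.
apply: (measurability _ (RGenOpens.measurableE R)).
move=> _ [_ [a [b ->] <-]]; rewrite setTI.
by apply: open_borelRn; apply: cf; exact: interval_open.
Qed.

Section CompactSupport.
Variables (R : realType) (p : nat) (S : set 'rV[R]_p).
Variable mu : probability (borelRn R p) R.
Hypotheses (cS : compact S) (muS : prob_on S mu).

Lemma compact_borelRn : measurable (S : set (borelRn R p)).
Proof.
by apply: closed_borelRn; apply: compact_closed cS; exact: norm_hausdorff.
Qed.

Lemma prob_on_compl0 : mu (~` S) = 0%E.
Proof.
apply: measure_negligible muS; apply: measurableC; exact: compact_borelRn.
Qed.

Lemma prob_onE : mu S = 1%E.
Proof.
have := probability_setC mu (measurableC compact_borelRn).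
by rewrite setCK prob_on_compl0 sube0.
Qed.

Lemma continuous_integrable (f : 'rV[R]_p -> R) : continuous f ->
  mu.-integrable (S : set (borelRn R p)) (EFin \o f).
Proof.
move=> cf; apply: measurable_bounded_integrable => /=.
- exact: compact_borelRn.
- by rewrite (le_lt_trans (probability_le1 _ compact_borelRn))// ltry.
- by apply: continuous_borelRn => //; exact: compact_borelRn.
- have : compact (f @` S).
    by apply: continuous_compact => //; exact: continuous_subspaceT.
  move/compact_bounded => [M [Mr fM]]; exists M; split => // x Mx y Sy.
  by apply: (fM x Mx); exists y.
Qed.

(** A continuous function is integrable over the compact set that carries mu,
    even if it is unbounded on the whole space. *)
Lemma expectation_compact (f : 'rV[R]_p -> R) : continuous f ->
  ('E_mu[f] = \int[mu]_(x in (S : set (borelRn R p))) (f x)%:E)%E.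
Proof.
move=> cf; rewrite unlock.
have mS := compact_borelRn.
have mNS : measurable (~` S : set (borelRn R p)) by exact: measurableC.
have intf : mu.-integrable setT (EFin \o f : borelRn R p -> \bar R).
  have mf : measurable_fun setT (EFin \o f : borelRn R p -> \bar R).
    by apply/measurable_EFinP; exact: continuous_borelRn.
  apply/(negligible_integrable mNS measurableT mf prob_on_compl0).
  by rewrite setTD setCK; exact: continuous_integrable.
rewrite (negligible_integral mNS measurableT intf prob_on_compl0).
by rewrite setTD setCK.
Qed.

End CompactSupport.

(** Integrability of the monomials comes from the compactness of S and the
    finiteness of mu, which makes the integral linear. *)
Lemma admits_pairing (R : realType) (p d : nat) (S : set 'rV[R]_p)
    (mu : probability (borelRn R p) R) (y q : tms R p d) :
  compact S -> admits S mu y ->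
  ((pairing q y)%:E = \int[mu]_(x in (S : set (borelRn R p)))
     (pairing q (monvec d (x : 'rV[R]_p)))%:E)%E.
Proof.
move=> cS muy; have mS := compact_borelRn cS.
pose g (k : 'I_#|expo p d|) (x : borelRn R p) : R :=
  @monomial R p d (enum_val k) x.
have ig k : mu.-integrable (S : set (borelRn R p)) (EFin \o g k).
  by apply: continuous_integrable => //; exact: monomial_continuous.
rewrite (eq_integral (fun x => \sum_k (q k ord0)%:E * (g k x)%:E)%E);
  last first.
  by move=> x _; rewrite /pairing -sumEFin; apply: eq_bigr => k _; rewrite mxE.
rewrite integral_sum//; last by move=> k; exact: integrableZl (ig k).
rewrite /pairing -sumEFin; apply: eq_bigr => k _.
by rewrite (integralZl mS (ig k)) EFinM muy.
Qed.

(** * Finitely supported probabilities *)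

(** The integrand has no sign, so that the formula is first proved for
    nonnegative functions and then applied to the positive and negative parts. *)
Lemma discrete_probability d (T : measurableType d) (R : realType) (I : finType)
    (u : I -> R) (x : I -> T) : (forall i, 0 <= u i) -> \sum_i u i = 1 ->
  exists mu : probability T R,
    (forall D : set T, mu D = (\sum_i u i * \1_D (x i))%:E) /\
    forall (D : set T) (f : T -> R), measurable D -> measurable_fun D f ->
    (\int[mu]_(y in D) (f y)%:E)%E = (\sum_i u i * \1_D (x i) * f (x i))%:E.
Proof.
move=> u0 u1.
pose dm i : {measure set T -> \bar R} := mscale (NngNum (u0 i)) (\d_(x i))%R.
pose m_ (k : nat) : {measure set T -> \bar R} :=
  if insub k is Some j then dm (enum_val (j : 'I_#|I|)) else mzero.
have mE A : msum m_ #|I| A = (\sum_i u i * \1_A (x i))%:E.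
  rewrite /msum -sumEFin [RHS](reindex _ (onW_bij _ (@enum_val_bij I))).
  apply: eq_bigr => j _; rewrite /m_ valK.
  by rewrite /= /mscale/= diracE indicE -EFinM.
have mT : msum m_ #|I| setT = 1%E.
  by rewrite mE; under eq_bigr do rewrite indicT mulr1; rewrite u1.
pose isP := Measure_isProbability.Build _ _ _ (msum m_ #|I|) mT.
pose mu : probability T R := HB.pack (msum m_ #|I|) isP.
exists mu; split => // D f mD mf.
have ge0_int (g : T -> R) : measurable_fun D g -> (forall y, 0 <= g y) ->
    (\int[mu]_(y in D) (g y)%:E)%E = (\sum_i u i * \1_D (x i) * g (x i))%:E.
  move=> mg g0.
  have mEg : measurable_fun D (EFin \o g) by exact/measurable_EFinP.
  rewrite ge0_integral_measure_sum//; last by move=> y _; rewrite lee_fin.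
  rewrite -sumEFin [RHS](reindex _ (onW_bij _ (@enum_val_bij I))).
  apply: eq_bigr => j _; rewrite /m_ valK.
  rewrite ge0_integral_mscale//; last by move=> y _; rewrite lee_fin.
  by rewrite integral_dirac// diracE indicE -!EFinM mulrA.
rewrite integralE -[(fun y => (f y)%:E)]/(EFin \o f) funerpos funerneg.
rewrite !ge0_int//; [|exact: measurable_funrneg|exact: measurable_funrpos].
rewrite -EFinB -sumrB; congr (_%:E); apply: eq_bigr => i _.
by rewrite -mulrBr -[in RHS](funrposBneg f).
Qed.

(** * Convexity of conically constrained sets *)

(** With a, b, c the sums of x^2, y^2, xy, the sum of (b x - c y)^2 equals
    b (a b - c^2) and is nonnegative. *)
Lemma cauchy_schwarz (R : realType) (I : finType) (x y : I -> R) :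
  (\sum_i x i * y i) ^+ 2 <= (\sum_i x i ^+ 2) * (\sum_i y i ^+ 2).
Proof.
set c := \sum_i x i * y i; set a := \sum_i x i ^+ 2; set b := \sum_i y i ^+ 2.
have b0 : 0 <= b by apply: sumr_ge0 => i _; exact: sqr_ge0.
have : 0 <= \sum_i (b * x i - c * y i) ^+ 2.
  by apply: sumr_ge0 => i _; exact: sqr_ge0.
rewrite (_ : \sum_i _ = b * (a * b - c ^+ 2)); last first.
  rewrite (eq_bigr (fun i => b ^+ 2 * x i ^+ 2 - 2 * b * c * (x i * y i)
    + c ^+ 2 * y i ^+ 2)); last by move=> i _; ring.
  by rewrite big_split sumrB -!mulr_sumr -/a -/b -/c /=; ring.
move: b0; rewrite le_eqVlt => /predU1P[b0 _|b0]; last first.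
  by rewrite pmulr_rge0// subr_ge0.
suff -> : c = 0 by rewrite expr0n/= -b0 mulr0.
apply: big1 => i _; move/esym/eqP: b0; rewrite psumr_eq0; last first.
  by move=> j _; exact: sqr_ge0.
move=> /allP/(_ i (mem_index_enum _)); rewrite sqrf_eq0 => /eqP ->.
by rewrite mulr0.
Qed.

Lemma norm2_ge0 (R : realType) (k : nat) (v : 'cV[R]_k) : 0 <= norm2 v.
Proof. exact: sqrtr_ge0. Qed.

Lemma norm2D (R : realType) (k : nat) (v w : 'cV[R]_k) :
  norm2 (v + w) <= norm2 v + norm2 w.
Proof.
have sq (z : 'cV[R]_k) : norm2 z ^+ 2 = \sum_i z i ord0 ^+ 2.
  by rewrite sqr_sqrtr// sumr_ge0// => i _; exact: sqr_ge0.
have vw : \sum_i v i ord0 * w i ord0 <= norm2 v * norm2 w.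
  apply: le_trans (ler_norm _) _.
  rewrite -ler_sqr ?nnegrE ?mulr_ge0 ?norm2_ge0//.
  by rewrite real_normK ?num_real// exprMn !sq; exact: cauchy_schwarz.
rewrite -ler_sqr ?nnegrE ?addr_ge0 ?norm2_ge0// sqrrD !sq.
under eq_bigr do rewrite mxE sqrrD.
by rewrite !big_split/= lerD2r lerD2l -mulr2n lerMn2r.
Qed.

Lemma norm2Z (R : realType) (k : nat) (u : R) (v : 'cV[R]_k) :
  0 <= u -> norm2 (u *: v) = u * norm2 v.
Proof.
move=> u0; rewrite /norm2; under eq_bigr do rewrite mxE exprMn.
by rewrite -mulr_sumr sqrtrM ?sqr_ge0// sqrtr_sqr ger0_norm.
Qed.

Lemma norm2_sum (R : realType) (k : nat) (I : finType) (u : I -> R)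
    (v : I -> 'cV[R]_k) : (forall i, 0 <= u i) ->
  norm2 (\sum_i u i *: v i) <= \sum_i u i * norm2 (v i).
Proof.
move=> u0; elim/big_ind2 : _ => [|x1 x2 y1 y2 h1 h2|i _].
- by rewrite -[X in norm2 X](scale0r 0) norm2Z// mul0r.
- exact: le_trans (norm2D _ _) (lerD h1 h2).
- by rewrite norm2Z.
Qed.

(** Every constraint asks an affine map to land in a convex cone, and affine
    maps commute with combinations whose weights add up to 1. *)
Lemma satisfies_convex (R : realType) (N : nat) (I : finType) (u : I -> R)
    (v : I -> 'cV[R]_N) (cc : conic_constraint R N) :
  (forall i, 0 <= u i) -> \sum_i u i = 1 ->
  (forall i, satisfies (v i) cc) -> satisfies (\sum_i u i *: v i) cc.
Proof.
move=> u0 u1.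
have comb (V : lmodType R) (f : {linear 'cV[R]_N -> V}) (f0 : V) :
    f (\sum_i u i *: v i) + f0 = \sum_i u i *: (f (v i) + f0).
  under [RHS]eq_bigr do rewrite scalerDr.
  rewrite big_split -scaler_suml u1 scale1r linear_sum; congr (_ + _).
  by apply: eq_bigr => i _; rewrite linearZ_LR.
have aff (q : 'cV[R]_N) (h : R) : (q^T *m (\sum_i u i *: v i)) ord0 ord0 + h =
    \sum_i u i * ((q^T *m v i) ord0 ord0 + h).
  under [RHS]eq_bigr do rewrite mulrDr.
  rewrite big_split -mulr_suml u1 mul1r mulmx_sumr summxE; congr (_ + _).
  by apply: eq_bigr => i _; rewrite -scalemxAr mxE.
case: cc => [q h|q h|k G g q h|k F0 F] sv /=.
- by rewrite aff big1// => i _; rewrite sv mulr0.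
- by rewrite aff sumr_ge0// => i _; rewrite mulr_ge0//; exact: sv.
- rewrite aff (comb _ (mulmx G)).
  apply: le_trans (norm2_sum _ u0) _.
  by apply: ler_sum => i _; rewrite ler_wpM2l//; exact: sv.
- have -> : F0 + \sum_j (\sum_i u i *: v i) j ord0 *: F j =
      \sum_i u i *: (F0 + \sum_j v i j ord0 *: F j).
    under [RHS]eq_bigr do rewrite scalerDr.
    rewrite big_split -scaler_suml u1 scale1r; congr (_ + _).
    under [RHS]eq_bigr do rewrite scaler_sumr.
    rewrite exchange_big; apply: eq_bigr => j _.
    rewrite summxE scaler_suml; apply: eq_bigr => i _.
    by rewrite scalerA mxE.
  split.
    rewrite linear_sum; apply: eq_bigr => i _.
    by rewrite linearZ/= (sv i).1.
  move=> w; rewrite mulmx_sumr mulmx_suml summxE sumr_ge0// => i _.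
  by rewrite -scalemxAr -scalemxAl mxE mulr_ge0//; exact: (sv i).2.
Qed.

Lemma conic_representable_convex (R : realType) (N : nat) (B : set 'cV[R]_N)
    (I : finType) (u : I -> R) (v : I -> 'cV[R]_N) : conic_representable B ->
  (forall i, 0 <= u i) -> \sum_i u i = 1 -> (forall i, B (v i)) ->
  B (\sum_i u i *: v i).
Proof.
move=> [s [cc ->]] u0 u1 Bv k; apply: satisfies_convex => // i; exact: Bv.
Qed.

(** * Normalizing points of the ambiguity cone *)

Lemma admits_inj (R : realType) (p d : nat) (S : set 'rV[R]_p)
    (mu : probability (borelRn R p) R) (y z : tms R p d) :
  admits S mu y -> admits S mu z -> y = z.
Proof.
move=> muy muz; apply/matrixP => k j; rewrite ord1.
by apply: EFin_inj; rewrite muy muz.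
Qed.

(** Each generator of the cone has mass 1, so that the mass of y is the sum of
    its coefficients, and dividing by it leaves a convex combination of points
    of B. *)
Lemma ambiguity_cone_normalize (R : realType) (p d : nat) (S : set 'rV[R]_p)
    (B : set (tms R p d)) (y : tms R p d) :
  compact S -> conic_representable B -> ambiguity_cone S B y ->
  0 < pairing e1 y -> B ((pairing e1 y)^-1 *: y).
Proof.
move=> cS hB [s [u [v [u0 Mv yE]]]] y0.
have Bv i : B (v i).
  by case: (Mv i) => mu [_ [z Bz muz]] muv; rewrite (admits_inj muv muz).
have v1 i : pairing e1 (v i) = 1.
  case: (Mv i) => mu [muS _] muv; apply: EFin_inj.
  rewrite (admits_pairing _ cS muv).
  under eq_integral do rewrite pairing_e1_monvec.
  rewrite (integral_cst _ (compact_borelRn cS)) mul1e.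
  exact: (prob_onE cS muS).
have yu : pairing e1 y = \sum_i u i.
  by rewrite yE pairing_sumr; apply: eq_bigr => i _; rewrite v1 mulr1.
rewrite yu in y0 *; rewrite yE scaler_sumr; under eq_bigr do rewrite scalerA.
apply: conic_representable_convex => // [i|].
  by rewrite mulr_ge0// invr_ge0 ltW.
by rewrite -mulr_sumr mulVf// gt_eqF.
Qed.

(** * Weak duality *)

Section WeakDuality.
Variables (R : realType) (p d n m : nat) (r : 'I_n -> mpoly p R).
Variables (a b : 'I_m.+1 -> R) (lambda : R).

Lemma fmin_loss (t : R) (x : 'cV[R]_n) (xi : 'rV[R]_p) :
  fmin r a b t x lambda xi = lambda - loss a b (- portfolio r x xi - t).
Proof.
apply/esym/(big_morph (fun z => lambda - z)) => // z1 z2.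
by rewrite oppr_max addr_minr.
Qed.

Lemma fmin_le (j : 'I_m.+1) (t : R) (x : 'cV[R]_n) (xi : 'rV[R]_p) :
  fmin r a b t x lambda xi <= fpiece r a b j t x lambda xi.
Proof. exact: bigmin_le_cond. Qed.

Lemma fmin_ge (z t : R) (x : 'cV[R]_n) (xi : 'rV[R]_p) :
  (forall j, z <= fpiece r a b j t x lambda xi) ->
  z <= fmin r a b t x lambda xi.
Proof. by move=> zf; apply/bigmin_geP. Qed.

Variables (A : 'I_m.+1 -> 'M[R]_(#|expo p d|, n)) (c : 'I_m.+1 -> tms R p d).
Hypothesis hAc : forall j t (x : 'cV[R]_n) xi,
  fpiece r a b j t x lambda xi = pairing (fcoef a A c j t x) (monvec d xi).

(** A minimum of finitely many functions that are polynomial in xi by [hAc]. *)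
Lemma fmin_continuous (t : R) (x : 'cV[R]_n) :
  continuous (fmin r a b t x lambda).
Proof.
have cf j : continuous (fpiece r a b j t x lambda).
  rewrite (_ : fpiece _ _ _ _ _ _ _ =
      fun xi => pairing (fcoef a A c j t x) (monvec d xi)).
    exact: pairing_monvec_continuous.
  by apply/funext => xi; rewrite hAc.
rewrite /fmin; elim: (index_enum _) => [|j s IH] xi.
  by under eq_fun do rewrite big_nil; exact: cf.
under eq_fun do rewrite big_cons.
by apply: continuous_min; [exact: cf | exact: IH].
Qed.

(** The identity behind weak duality: a_j e_1 t contributes t because of the
    normalization of the y_j, and x contributes - x^T (gamma_0 e + gamma), where
    e^T x = 1. *)
Lemma sum_fcoef (g0 t : R) (g x : 'cV[R]_n) (y : 'I_m.+1 -> tms R p d) :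
  simplex x -> \sum_j a j * pairing e1 (y j) = 1 ->
  g0 *: const_mx 1 + g + \sum_j (A j)^T *m y j = 0 ->
  \sum_j pairing (fcoef a A c j t x) (y j) =
    t - D_objective c g0 y - \sum_i g i ord0 * x i ord0.
Proof.
move=> [_ x1] y1 gy.
have fE j : pairing (fcoef a A c j t x) (y j) =
    t * (a j * pairing e1 (y j)) + (x^T *m ((A j)^T *m y j)) ord0 ord0
      + pairing (c j) (y j).
  rewrite /fcoef !pairingDl pairingZl [pairing (A j *m x) _]pairingE.
  by rewrite trmx_mul mulmxA; ring.
under eq_bigr do rewrite fE.
rewrite !big_split/= -mulr_sumr y1 mulr1 -summxE -mulmx_sumr.
have -> : \sum_j (A j)^T *m y j = - (g0 *: const_mx 1 + g).
  by apply/eqP; rewrite -addr_eq0 addrC gy.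
rewrite mulmxN mxE.
have -> : (x^T *m (g0 *: const_mx 1 + g)) ord0 ord0 =
    g0 + \sum_i g i ord0 * x i ord0.
  rewrite mxE (eq_bigr (fun i => g0 * x i ord0 + g i ord0 * x i ord0)).
    by rewrite big_split/= -mulr_sumr x1 mulr1.
  by move=> i _; rewrite !mxE; ring.
rewrite /D_objective; ring.
Qed.

Lemma expectation_loss_le (S : set 'rV[R]_p) (mu : probability (borelRn R p) R)
    (t : R) (x : 'cV[R]_n) : compact S -> prob_on S mu ->
  ('E_mu[fun xi => loss a b (- portfolio r x xi - t)%R] <= lambda%:E)%E =
  (0 <= 'E_mu[fmin r a b t x lambda])%E.
Proof.
move=> cS muS.
have cf := @fmin_continuous t x.
have lf xi : loss a b (- portfolio r x xi - t) =
    lambda - fmin r a b t x lambda xi.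
  by rewrite fmin_loss subKr.
have cl : continuous (fun xi => loss a b (- portfolio r x xi - t)).
  rewrite (_ : (fun _ => _) = cst lambda - fmin r a b t x lambda).
    by move=> xi; apply: continuousB; [exact: cst_continuous | exact: cf].
  by apply/funext => xi; rewrite lf.
have int_f := continuous_integrable mu cS cf.
rewrite !(expectation_compact cS muS)//.
under eq_integral do rewrite lf EFinB.
have mS := compact_borelRn cS.
have int_c : mu.-integrable (S : set (borelRn R p)) (EFin \o cst lambda).
  by apply: continuous_integrable => //; exact: cst_continuous.
have int_l : (\int[mu]_(x in (S : set (borelRn R p))) lambda%:E = lambda%:E)%E.
  rewrite (integral_cst _ mS) -[RHS]mule1; congr (_ * _)%E.
  exact: (prob_onE cS muS).
rewrite (integralB_EFin mS int_c int_f) int_l.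
rewrite -(fineK (integrable_fin_num mS int_f)) -EFinB !lee_fin.
by rewrite gerBl.
Qed.

(** The polynomial w separates min_j f_j from 0: it lies below every f_j on S
    and has a nonnegative integral against each measure of the ambiguity set. *)
Lemma P_feasible_expectation (S : set 'rV[R]_p) (B : set (tms R p d))
  (mu : probability (borelRn R p) R) t x w : compact S ->
  P_feasible S (ambiguity_cone S B) a A c t x w -> ambiguity S B mu ->
  (0 <= 'E_mu[fmin r a b t x lambda])%E.
Proof.
move=> cS [Kw _ wS] /[dup] Mmu [muS [y By muy]].
have Ky : ambiguity_cone S B y.
  exists 1%N, (fun=> 1), (fun=> y); split => // [_|]; first by exists mu.
  by rewrite big_ord1 scale1r.
have cf := @fmin_continuous t x.
rewrite (expectation_compact cS muS cf).
apply: (@le_trans _ _ (pairing w y)%:E); first by rewrite lee_fin; exact: Kw.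
rewrite (admits_pairing _ cS muy); apply: le_integral.
- exact: compact_borelRn.
- by apply: continuous_integrable => //; exact: pairing_monvec_continuous.
- exact: continuous_integrable.
move=> xi /set_mem Sxi; rewrite lee_fin; apply: fmin_ge => j; rewrite hAc.
have := wS j xi Sxi; rewrite pairingDl -scaleN1r pairingZl mulN1r.
by rewrite subr_ge0.
Qed.

(** One measure, independent of (t, x), serves all primal points: it consists of
    the atoms of all the y_j. The bound on the expectation replaces min_i f_i by
    f_j at the atoms of y_j. *)
Lemma dual_feasible_measure (S : set 'rV[R]_p) (B : set (tms R p d))
    (g0 : R) (g : 'cV[R]_n) (y : 'I_m.+1 -> tms R p d) :
  compact S -> conic_representable B ->
  closure (ambiguity_cone S B) = ambiguity_cone S B ->
  D_feasible S (ambiguity_cone S B) a A g0 g y ->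
  exists (k : R) (mu : probability (borelRn R p) R) (z : tms R p d),
    [/\ 0 < k, ambiguity S B mu, admits S mu z, \sum_j y j = k *: z &
      forall t x, simplex x ->
      ('E_mu[fmin r a b t x lambda] <=
        (k^-1 * (t - D_objective c g0 y))%R%:E)%E].
Proof.
move=> cS hB clK [g_ge0 y_cl y1 gy Ky]; rewrite clK in Ky.
have y_mom j : moment_cone d S (y j).
  exact: (moment_cone_closed cS (y_cl j)).
have [I [u [xi [lab [u0 Sxi yE]]]]] := moment_cone_atoms y_mom.
have sum_atoms (q : 'I_m.+1 -> tms R p d) : \sum_j pairing (q j) (y j) =
    \sum_i u i * pairing (q (lab i)) (monvec d (xi i)).
  rewrite [RHS](partition_big lab xpredT)//=; apply: eq_bigr => j _.
  by rewrite yE pairing_sumr; apply: eq_bigr => i /eqP ->.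
have sum_y : \sum_j y j = \sum_i u i *: monvec d (xi i).
  by rewrite [RHS](partition_big lab xpredT)//=; apply: eq_bigr => j _.
pose k := \sum_i u i.
have kE : pairing e1 (\sum_j y j) = k.
  rewrite sum_y pairing_sumr; apply: eq_bigr => i _.
  by rewrite pairing_e1_monvec mulr1.
have k_gt0 : 0 < k.
  (* If all weights vanished, so would the sum of the a_j <e_1, y_j>. *)
  rewrite lt_neqAle sumr_ge0// andbT; apply/negP => /eqP/esym/eqP.
  rewrite psumr_eq0// => /allP u_eq0.
  have := sum_atoms (fun j => a j *: e1).
  under eq_bigr do rewrite pairingZl.
  rewrite y1 big1 => [/eqP|i _]; first by rewrite oner_eq0.
  by rewrite (eqP (u_eq0 i (mem_index_enum i))) mul0r.
have [||mu [mu_set mu_int]] := @discrete_probability _ (borelRn R p) R I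
    (fun i => k^-1 * u i) xi.
- by move=> i; rewrite mulr_ge0// invr_ge0 ltW.
- by rewrite -mulr_sumr mulVf// gt_eqF.
have mS := compact_borelRn cS.
have muS : prob_on S mu.
  exists (~` S); split => //; first exact: measurableC.
  rewrite mu_set big1// => i _.
  by rewrite indicE memNset ?mulr0// => /(_ (Sxi i)).
have mu_z : admits S mu (k^-1 *: \sum_j y j).
  move=> l; rewrite mu_int//; last first.
    by apply: continuous_borelRn => //; exact: monomial_continuous.
  rewrite sum_y mxE summxE mulr_sumr; congr (_%:E); apply: eq_bigr => i _.
  by rewrite indicE mem_set ?mulr1// !mxE mulrA.
exists k, mu, (k^-1 *: \sum_j y j); split => //.
- split => //; exists (k^-1 *: \sum_j y j) => //.
  by have := ambiguity_cone_normalize cS hB Ky; rewrite kE; exact.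
- by rewrite scalerA divff ?scale1r// gt_eqF.
move=> t x sx; rewrite unlock mu_int//; last first.
  by apply: continuous_borelRn => //; exact: fmin_continuous.
rewrite lee_fin; under eq_bigr do rewrite indicT mulr1 -mulrA.
rewrite -mulr_sumr; apply: ler_wpM2l; first by rewrite invr_ge0 ltW.
apply: (@le_trans _ _
  (\sum_i u i * pairing (fcoef a A c (lab i) t x) (monvec d (xi i)))).
  by apply: ler_sum => i _; rewrite ler_wpM2l// -hAc fmin_le.
rewrite -(sum_atoms (fun j => fcoef a A c j t x)) (sum_fcoef _ sx y1 gy) gerBl.
by apply: sumr_ge0 => i _; rewrite mulr_ge0//; exact: sx.1.
Qed.

End WeakDuality.

(** * Equality of the values and the worst-case measure *)

Unset Implicit Arguments.
Set Strict Implicit.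
Set Printing Implicit Defensive.

Theorem theorem3p3 (R : realType) (p d n m : nat)
    (S : set 'rV[R]_p) (B : set (tms R p d))
    (r : 'I_n -> mpoly p R) (lambda : R) (a b : 'I_m.+1 -> R)
    (A : 'I_m.+1 -> 'M[R]_(#|expo p d|, n)) (c : 'I_m.+1 -> tms R p d)
    (K := ambiguity_cone S B) (M := ambiguity S B)
    (hr : (\max_(i < n) (msize (r i)).-1)%N = d)
    (hlambda : 0 < lambda)
    (hl_incr : {homo loss a b : z1 z2 / z1 <= z2})
    (hl_nconst : exists z1 z2, loss a b z1 <> loss a b z2)
    (hB : conic_representable B)
    (hK : K = moment_cone d S `&` conic_hull B)
    (hAc : forall j t (x : 'cV[R]_n) xi,
       fpiece r a b j t x lambda xi = pairing (fcoef a A c j t x) (monvec d xi))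
    (t_opt : R) (x_opt : 'cV[R]_n) (w_opt : tms R p d)
    (hP : P_optimizer S K a A c t_opt x_opt w_opt)
    (g0_opt : R) (g_opt : 'cV[R]_n) (y_opt : 'I_m.+1 -> tms R p d)
    (hD : D_optimizer S K a A c g0_opt g_opt y_opt)
    (hS : compact S)
    (hKcl : K = closure K)
    (hsd : P_value S K a A c = D_value S K a A c) :
  D_value S K a A c = dro_value r a b M lambda /\
  exists (k : R) (mu : probability (borelRn R p) R),
    [/\ k != 0, M mu,
        exists2 z : tms R p d, admits S mu z & \sum_j y_opt j = k *: z,
        ('E_mu[fun xi => fmin r a b t_opt x_opt lambda xi])%E =
          ereal_inf
            [set ('E_nu[fun xi => fmin r a b t_opt x_opt lambda xi])%E | nu in M] &
        ereal_inf
          [set ('E_nu[fun xi => fmin r a b t_opt x_opt lambda xi])%E | nu in M] = 0%E].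
Proof.
case: hP => Pfeas Popt; case: hD => Dfeas Dopt.
have Pval : P_value S K a A c = t_opt%:E.
  apply/eqP; rewrite eq_le; apply/andP; split.
    by apply: ereal_inf_lbound; exists t_opt => //; exists x_opt, w_opt.
  apply: le_ereal_inf_tmp => _ [t [x [w tP]] <-]; rewrite lee_fin.
  exact: Popt tP.
have Dval : D_value S K a A c = (D_objective c g0_opt y_opt)%:E.
  apply/eqP; rewrite eq_le; apply/andP; split.
    apply: ge_ereal_sup => _ [_ [g0 [g [y [gyD ->]]]] <-].
    by rewrite lee_fin; exact: Dopt gyD.
  by apply: ereal_sup_ubound; exists (D_objective c g0_opt y_opt) => //;
    exists g0_opt, g_opt, y_opt.
have Dt : D_objective c g0_opt y_opt = t_opt.
  by apply: EFin_inj; rewrite -Dval -hsd Pval.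
have [k [mu [z [k0 Mmu mu_z yz mu_le]]]] :=
  dual_feasible_measure hAc hS hB (esym hKcl) Dfeas.
have fmin_ge0 nu : M nu -> (0 <= 'E_nu[fmin r a b t_opt x_opt lambda])%E.
  exact: (P_feasible_expectation hAc hS Pfeas).
have simplex_opt : simplex x_opt by case: Pfeas.
have mu0 : ('E_mu[fmin r a b t_opt x_opt lambda] = 0)%E.
  apply/eqP; rewrite eq_le fmin_ge0// andbT.
  by apply: le_trans (mu_le t_opt x_opt simplex_opt) _; rewrite Dt subrr mulr0.
have inf0 : ereal_inf
    [set ('E_nu[fun xi => fmin r a b t_opt x_opt lambda xi])%E | nu in M] = 0%E.
  apply/eqP; rewrite eq_le; apply/andP; split.
    by apply: ereal_inf_lbound; exists mu.
  by apply: le_ereal_inf_tmp => _ [nu Mnu <-]; exact: fmin_ge0.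
split; last first.
  exists k, mu; split => //; first by rewrite gt_eqF.
    by exists z.
  by rewrite inf0.
rewrite Dval Dt; apply/eqP; rewrite eq_le; apply/andP; split.
  apply: le_ereal_inf_tmp => _ [t [x [loss_le sx]] <-]; rewrite lee_fin.
  have : (0 <= 'E_mu[fmin r a b t x lambda])%E.
    rewrite -(expectation_loss_le hAc t x hS Mmu.1).
    by apply: le_trans loss_le; apply: ereal_sup_ubound; exists mu.
  move=> /le_trans/(_ (mu_le t x sx)); rewrite lee_fin Dt.
  by rewrite pmulr_rge0 ?invr_gt0// subr_ge0.
apply: ereal_inf_lbound; exists t_opt => //; exists x_opt; split => //.
apply: ge_ereal_sup => _ [nu Mnu <-].
rewrite (expectation_loss_le hAc _ _ hS Mnu.1); exact: fmin_ge0.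
Qed.
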